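(* Let $p,q,l$ be positive integers and let $\mathcal{P}$ be a nonnegative symmetric sign pattern (all entries in $\{+,0\}$) with all diagonal entries equal to $0$ whose underlying graph $G(\mathcal{P})$ is the dumbbell graph $D_{4p+2,4q+2,2l-1}$, i.e. the graph consisting of two vertex-disjoint cycles of lengths $4p+2$ and $4q+2$ joined by a path of length $2l+1$ (having $2l$ internal vertices) that shares only its two end vertices with the cycles, one with each cycle. Then $\mathcal{P}$ requires full $P$-vertices.
   Context: A sign pattern of order $N$ is an $N\times N$ matrix $\mathcal{P}=[p_{ij}]$ with entries in $\{+,-,0\}$; it is symmetric if $p_{ij}=p_{ji}$ for all $i,j$. $\mathcal{Q}_{\mathrm{SYM}}(\mathcal{P})$ is the set of all real symmetric $N\times N$ matrices $A=[a_{ij}]$ with $\mathrm{sgn}(a_{ij})=p_{ij}$ for all $i,j$. The underlying graph $G(\mathcal{P})$ is the undirected graph on vertices $v_1,\dots,v_N$ with an edge $\{v_i,v_j\}$ exactly when $p_{ij}\neq 0$. For $a,b\ge 3$ and $c\ge -1$, the dumbbell graph $D_{a,b,c}$ is the bicyclic graph obtained from two vertex-disjoint cycles $C_a$ and $C_b$ by joining them by a path $u_1,v_1,\dots,v_{c+1},w_1$ with $c+3$ vertices (so with $c+2$ edges) having only its end vertices $u_1\in V(C_a)$ and $w_1\in V(C_b)$ in common with the two cycles. For a real symmetric matrix $A$, $m_A(0)$ is the algebraic multiplicity of $0$ as an eigenvalue of $A$ (zero if $0$ is not an eigenvalue), and $A(j)$ is the principal submatrix obtained by deleting row and column $j$.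 The vertex $v_j$ is a $P$-vertex of $A$ if $m_{A(j)}(0)-m_A(0)=1$. The pattern $\mathcal{P}$ of order $N$ requires full $P$-vertices if, for every $A\in\mathcal{Q}_{\mathrm{SYM}}(\mathcal{P})$, all $N$ vertices are $P$-vertices of $A$. *)

(* Defs.v *)
From HB Require Import structures.
From mathcomp Require Import all_boot all_order all_algebra.
From mathcomp Require Import reals.

Set Implicit Arguments.
Unset Strict Implicit.
Unset Printing Implicit Defensive.

Import GRing.Theory Num.Theory.
Local Open Scope ring_scope.

Inductive sign := Plus | Minus | Zero.

Definition int_of_sign (s : sign) : int :=
  match s with Plus => 1 | Minus => -1 | Zero => 0 end.

Lemma int_of_sign_inj : injective int_of_sign.
Proof. by case; case. Qed.

HB.instance Definition _ := Equality.copy sign (inj_type int_of_sign_inj).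

Definition symmetric_pattern (N : nat) (P : 'M[sign]_N) : Prop :=
  forall i j, P i j = P j i.

Definition nonnegative_pattern (N : nat) (P : 'M[sign]_N) : Prop :=
  forall i j, P i j = Plus \/ P i j = Zero.

Definition zero_diagonal (N : nat) (P : 'M[sign]_N) : Prop :=
  forall i, P i i = Zero.

Definition Q_SYM (R : realType) (N : nat) (P : 'M[sign]_N) (A : 'M[R]_N) : Prop :=
  A^T = A /\ forall i j, sgz (A i j) = int_of_sign (P i j).

Definition underlying_graph (N : nat) (P : 'M[sign]_N) : rel 'I_N :=
  fun i j => P i j != Zero.

Definition graph_iso (V W : Type) (e : rel V) (e' : rel W) : Prop :=
  exists2 f : V -> W, bijective f & forall x y, e x y = e' (f x) (f y).

(* The dumbbell graph is indexed by the lengths a, b of its two cycles and by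
   the number k of internal vertices of the connecting path, so that D_{a,b,c}
   (a, b >= 3 and c >= -1) corresponds to k = c + 1. *)
Inductive dumbbell_vertex (a b k : nat) :=
  | LeftCycle of 'I_a
  | PathInternal of 'I_k
  | RightCycle of 'I_b.

(* Every edge is oriented once here. The path leaves the left cycle at its
   vertex 0 and enters the right cycle at its vertex 0; when k = 0 it is the
   single edge between these two vertices. *)
Definition dumbbell_arc (a b k : nat) : rel (dumbbell_vertex a b k) :=
  fun x y => match x, y with
  | LeftCycle i, LeftCycle j => j == ordS i
  | RightCycle i, RightCycle j => j == ordS i
  | LeftCycle i, PathInternal j => (val i == 0)%N && (val j == 0)%N
  | PathInternal i, PathInternal j => (val j == (val i).+1)%N
  | PathInternal i, RightCycle j => ((val i).+1 == k)%N && (val j == 0)%N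
  | LeftCycle i, RightCycle j => [&& k == 0, val i == 0 & val j == 0]%N
  | _, _ => false
  end.

Definition dumbbell (a b k : nat) : rel (dumbbell_vertex a b k) :=
  fun x y => dumbbell_arc x y || dumbbell_arc y x.

(* The algebraic multiplicity m_A(0). *)
Definition mult0 (R : realType) (n : nat) (A : 'M[R]_n) : nat :=
  mup 0 (char_poly A).

Definition P_vertex (R : realType) (N : nat) (A : 'M[R]_N) (j : 'I_N) : Prop :=
  (mult0 (row' j (col' j A)))%:Z - (mult0 A)%:Z = 1.

Definition requires_full_P_vertices (R : realType) (N : nat)
    (P : 'M[sign]_N) : Prop :=
  forall A : 'M[R]_N, Q_SYM P A -> forall j : 'I_N, P_vertex A j.

(* Main.v *)
(** The equations of A x = 0 at the degree-2 vertices of a walk force x to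
    alternate in sign along every second vertex.  Going round a cycle of length
    4p+2 from its attachment vertex takes an odd number 2p+1 of such steps, so x
    vanishes there; being zero at both ends, x vanishes on the whole path, whose
    number of internal vertices is even; finally the two cycle neighbours of an
    attachment vertex carry values of the same sign, so its own equation kills
    the remaining values.  Hence A is invertible.  The dumbbell is bipartite, so
    A and therefore A^-1 anticommute with a diagonal sign matrix, and A^-1 has
    zero diagonal.  Thus det A(j) = 0, and 0 is a simple root of the
    characteristic polynomial of A(j) because (A^-2)_jj > 0. *)

From HB Require Import structures.
Require Import Defs.
From mathcomp Require Import all_boot all_order all_algebra.
From mathcomp Require Import reals.
From mathcomp Require Import zify ring lra.

Set Implicit Arguments.
Unset Strict Implicit.
Unset Printing Implicit Defensive.

Import Order.TTheory GRing.Theory Num.Theory.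
Local Open Scope ring_scope.

(** * Characteristic polynomials, the multiplicity of 0, and the diagonal of the inverse *)

(** The cofactor sign is (-1)^(j+j) = 1, and deleting row and column j of X - A leaves X - A(j).
    This brings A(j) into the adjugate identity. *)
Lemma adj_char_poly_mx_diag (R : comNzRingType) (n : nat) (A : 'M[R]_n) (j : 'I_n) :
  (\adj (char_poly_mx A)) j j = char_poly (row' j (col' j A)).
Proof.
rewrite mxE /cofactor -signr_odd addnn odd_double mul1r /char_poly.
congr (\det _); apply/matrixP => x y.
by rewrite !mxE (inj_eq lift_inj).
Qed.

Lemma mup0_eq1 (F : fieldType) (f : {poly F}) : f`_0 = 0 -> f`_1 != 0 -> mup 0 f = 1%N.
Proof.
move=> f0 f1.
have fN0 : f != 0 by apply: contraNneq f1 => ->; rewrite coef0.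
have rf : root f 0 by rewrite rootE horner_coef0 f0.
apply/eqP; rewrite eqn_leq mup_leq // mup_geq // expr1 dvdp_XsubCl rf andbT.
rewrite subr0; apply: contra f1 => /dvdpP[g ->].
by rewrite coefMXn.
Qed.

Lemma mup0_char_poly_unit (F : fieldType) (n : nat) (A : 'M[F]_n) :
  A \in unitmx -> mup 0 (char_poly A) = 0%N.
Proof.
rewrite unitmxE unitfE => detA; apply: mupNroot.
by rewrite rootE horner_coef0 char_poly_det mulf_neq0 // signr_eq0.
Qed.

(* Comparing coefficients in (X - A) * adj (X - A) = char_poly A gives, modulo
   X^2, adj (X - A) = - c0 A^-1 - X (c0 A^-2 + c1 A^-1), where c0 <> 0 and
   (A^-2)_jj > 0 is the squared norm of row j of A^-1. *)
Lemma mup0_char_poly_minor (F : realFieldType) (n : nat) (A : 'M[F]_n) (j : 'I_n) :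
  A^T = A -> A \in unitmx -> (invmx A) j j = 0 ->
  mup 0 (char_poly (row' j (col' j A))) = 1%N.
Proof.
move=> symA uA invA0.
pose c k := (char_poly A)`_k.
pose G k : 'M[F]_n := \matrix_(x, y) ((\adj (char_poly_mx A)) x y)`_k.
have coefG k : A *m G k = (if k is k'.+1 then G k' else 0) - (c k)%:M.
  apply/matrixP => x y; move/matrixP/(_ x y): (mul_mx_adj (char_poly_mx A)).
  rewrite mulmxBl mul_scalar_mx !mxE => /(congr1 (coefp k)).
  rewrite /= coefB coefXM coef_sum coefMn -/(char_poly A) -/(c k) => <-.
  under [in RHS]eq_bigr => z _ do rewrite mxE coefCM.
  under eq_bigr => z _ do rewrite mxE.
  by case: k => [|k]; rewrite !mxE opprB addrCA subrr addr0.
have c0 : c 0%N != 0.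
  rewrite /c char_poly_det mulf_neq0 ?signr_eq0 //.
  by rewrite unitmxE unitfE in uA.
have G0 : G 0%N = - c 0%N *: invmx A.
  rewrite -[LHS](mulKmx uA) coefG sub0r -scaleN1r -scalemx1 !scalerA.
  by rewrite mulN1r -scalemxAr mulmx1.
have G1 : G 1%N = - c 0%N *: (invmx A *m invmx A) - c 1%N *: invmx A.
  by rewrite -[LHS](mulKmx uA) coefG G0 mulmxBr -scalemxAr -scalemx1 -scalemxAr mulmx1.
have coefP k : (char_poly (row' j (col' j A)))`_k = G k j j.
  by rewrite -adj_char_poly_mx_diag [RHS]mxE.
apply: mup0_eq1; first by rewrite coefP G0 mxE invA0 mulr0.
have symV : (invmx A)^T = invmx A by rewrite trmx_inv symA.
rewrite coefP G1 !mxE invA0 mulr0 subr0 mulf_neq0 ?oppr_eq0 //.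
have sqE k : invmx A j k * invmx A k j = (invmx A j k) ^+ 2.
  by rewrite -{2}symV mxE expr2.
under eq_bigr => k _ do rewrite sqE.
apply/eqP => /psumr_eq0P sum0.
have row0 : row j (invmx A) = 0.
  apply/rowP => k; rewrite !mxE; apply/eqP; rewrite -sqrf_eq0.
  by apply/eqP/sum0 => // i _; rewrite sqr_ge0.
have : row j (invmx A *m A) = 0 by rewrite row_mul row0 mul0mx.
rewrite mulVmx // => /rowP/(_ j); rewrite !mxE eqxx => /eqP.
by rewrite oner_eq0.
Qed.

Lemma invmx_diag_eq0 (F : realFieldType) (n : nat) (A : 'M[F]_n) (side : 'I_n -> bool) (j : 'I_n) :
  A \in unitmx -> (forall x y, side x = side y -> A x y = 0) -> invmx A j j = 0.
Proof.
move=> uA bip.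
(* [B] is - S A^-1 S, where S is the diagonal matrix of the signs (-1)^side. Once [B] equals A^-1,
   each diagonal entry is its own opposite. *)
pose B : 'M[F]_n := \matrix_(x, y) ((-1) ^+ (~~ (side x (+) side y)) * invmx A x y).
suff: B = invmx A.
  by move/matrixP/(_ j j); rewrite mxE addbb expr1; lra.
rewrite -[LHS](mulKmx uA) -[RHS]mulmx1; congr (_ *m _).
rewrite -(mulmxV uA); apply/matrixP => x y; move/matrixP/(_ x y): (mulmxV uA); rewrite !mxE => E.
(* A nonzero [A x k] forces x and k onto opposite sides, so the sign in [B k y] depends only on x
   and y and leaves the sum. *)
transitivity ((-1) ^+ (side x (+) side y) * \sum_k A x k * invmx A k y).
  rewrite mulr_sumr; apply: eq_bigr => k _; rewrite mxE.
  case Exk: (side x == side k).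
    by rewrite (bip x k) ?(eqP Exk) // !mul0r mulr0.
  suff -> : ~~ (side k (+) side y) = side x (+) side y by rewrite mulrCA.
  by move: Exk; case: (side x) (side k) (side y) => [] [] [].
rewrite E; case: eqP => [->|_]; first by rewrite addbb mul1r.
by rewrite mulr0.
Qed.

(** * Null vectors along walks in a weighted graph *)

(** Matrices are functions on vertices here, so that the argument runs on the dumbbell itself. *)
Definition weights (F : numDomainType) (V : finType) (e : rel V) (w : V -> V -> F) : Prop :=
  forall u v, if e u v then 0 < w u v else w u v == 0.

Definition null_vector (F : numDomainType) (V : finType) (w : V -> V -> F) (x : V -> F) : Prop :=
  forall u, \sum_v w u v * x v = 0.

(** An explicit list turns the equation at a vertex into a sum of two or three terms. *)
Definition neighbours (V : eqType) (e : rel V) (v : V) (s : seq V) : Prop :=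
  uniq s /\ forall u, e v u = (u \in s).

Lemma null_vector_neighbours (F : numDomainType) (V : finType) (e : rel V)
    (w : V -> V -> F) (x : V -> F) (v : V) (s : seq V) :
  weights e w -> null_vector w x -> neighbours e v s ->
  all (fun u => 0 < w v u) s /\ \sum_(u <- s) w v u * x u = 0.
Proof.
move=> we kx [us ns]; split.
  by apply/allP => u; rewrite -ns => evu; have := we v u; rewrite evu.
rewrite -[RHS](kx v) big_uniq //= big_mkcond /=; apply: eq_bigr => u _.
by have := we v u; rewrite ns; case: ifP => // _ /eqP ->; rewrite mul0r.
Qed.

(** The equation a x(s(i-1)) + b x(s(i+1)) = 0 with a, b > 0 makes each double step multiply x by
    the negative factor -a/b. Only the sign of the product matters later. *)
Lemma null_vector_walk (F : realFieldType) (V : finType) (e : rel V)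
    (w : V -> V -> F) (x : V -> F) (s : nat -> V) (k m : nat) :
  weights e w -> null_vector w x ->
  (forall i, (k < i < k + 2 * m)%N -> neighbours e (s i) [:: s i.-1; s i.+1]) ->
  exists2 c, 0 < c & x (s (k + 2 * m)%N) = (-1) ^+ m * c * x (s k).
Proof.
move=> we kx; elim: m => [|m IHm] ns.
  by exists 1; rewrite ?ltr01 // muln0 addn0 !mul1r.
have [|c c0 xm] := IHm; first by move=> i ki; apply: ns; lia.
have [|] := null_vector_neighbours we kx (ns (k + 2 * m).+1 _); first by lia.
rewrite !big_cons big_nil addr0 => /and3P[a0 b0 _].
rewrite (_ : (k + 2 * m.+1 = (k + 2 * m).+2)%N); last by lia.
move: a0 b0; set a := w _ _; set b := w _ _ => a0 b0 E.
exists (a * c / b); first by rewrite divr_gt0 ?mulr_gt0.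
have -> : x (s (k + 2 * m).+2) = - (a * x (s (k + 2 * m)%N)) / b.
  apply: (mulfI (lt0r_neq0 b0)); rewrite mulrCA divff ?lt0r_neq0 //.
  by rewrite mulr1 -[RHS]addr0 -E addKr.
by rewrite xm exprS; field; rewrite lt0r_neq0.
Qed.

Section Walks.

Variables (F : realFieldType) (V : finType) (e : rel V).
Variables (w : V -> V -> F) (x : V -> F).
Hypotheses (we : weights e w) (wx : null_vector w x).

Lemma null_vector_walk_eq0 (s : nat -> V) (k m : nat) :
  (forall i, (k < i < k + 2 * m)%N -> neighbours e (s i) [:: s i.-1; s i.+1]) ->
  (x (s (k + 2 * m)%N) == 0) = (x (s k) == 0).
Proof.
move=> /(null_vector_walk we wx)[c c0 ->].
by rewrite !mulf_eq0 signr_eq0 (gt_eqF c0).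
Qed.

(** Double steps link the even indices to the start and, since 2l+1 is odd, the odd indices to the
    end. *)
Lemma null_vector_path (s : nat -> V) (l : nat) :
  (forall i, (0 < i < (2 * l).+1)%N -> neighbours e (s i) [:: s i.-1; s i.+1]) ->
  x (s 0%N) = 0 -> x (s (2 * l).+1) = 0 ->
  forall i, (i <= (2 * l).+1)%N -> x (s i) = 0.
Proof.
move=> ns x0 xl i il; apply/eqP; have := odd_double_half i.
case: (odd i) => /= [|<-]; last first.
  rewrite -muln2 mulnC add0n -[(2 * _)%N]add0n null_vector_walk_eq0 ?x0 //.
  by move=> j hj; apply: ns; lia.
move=> Ei; rewrite -(null_vector_walk_eq0 (m := (l - i./2)%N)).
  by rewrite (_ : (i + _ = (2 * l).+1)%N) ?xl //; lia.
by move=> j hj; apply: ns; lia.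
Qed.

(** [s] goes once round the cycle from its attachment vertex, and [t] is the neighbour of that
    vertex on the connecting path. *)
Lemma null_vector_cycle (s : nat -> V) (p : nat) (t : V) :
  s (4 * p + 2)%N = s 0%N ->
  (forall i, (0 < i < 4 * p + 2)%N -> neighbours e (s i) [:: s i.-1; s i.+1]) ->
  neighbours e (s 0%N) [:: s 1%N; s (4 * p + 1)%N; t] ->
  x (s 0%N) = 0 /\
  (x t = 0 -> forall i, (i <= 4 * p + 2)%N -> x (s i) = 0).
Proof.
move=> sa ns n0.
have x0 : x (s 0%N) = 0.
  (* A full turn is 2p+1 double steps, so x(s 0) = - c x(s 0) with c > 0. *)
  have [|c c0] := null_vector_walk (s := s) (k := 0%N) (m := (2 * p).+1) we wx.
    by move=> i hi; apply: ns; lia.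
  rewrite (_ : (0 + _ = 4 * p + 2)%N); last by lia.
  rewrite sa exprS exprM sqrrN !expr1n => /eqP.
  rewrite mulr1 mulN1r mulNr -subr_eq0 opprK -[X in X + _]mul1r -mulrDl.
  by rewrite mulf_eq0 gt_eqF ?addr_gt0 ?ltr01 //= => /eqP.
split=> // xt i hi; apply/eqP; have := odd_double_half i.
case: (odd i) => /= [Ei|<-]; last first.
  rewrite -muln2 mulnC add0n -[(2 * _)%N]add0n null_vector_walk_eq0 ?x0 //.
  by move=> j hj; apply: ns; lia.
(* Odd indices reduce to [s 1]. The 2p double steps from [s 1] to [s (4p+1)] preserve the sign, so
   the equation at [s 0] forces x(s 1) = 0. *)
rewrite -Ei -muln2 mulnC null_vector_walk_eq0; last by move=> j hj; apply: ns; lia.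
have [|c c0] := null_vector_walk (s := s) (k := 1%N) (m := (2 * p)%N) we wx.
  by move=> i' hi'; apply: ns; lia.
rewrite (_ : (1 + _ = 4 * p + 1)%N); last by lia.
rewrite exprM sqrrN !expr1n mul1r => x1.
have [/= /and4P[a0 b0 _ _]] := null_vector_neighbours we wx n0.
rewrite !big_cons big_nil addr0 xt mulr0 addr0 x1 mulrA -mulrDl => /eqP.
by rewrite mulf_eq0 gt_eqF // addr_gt0 // mulr_gt0.
Qed.

End Walks.

(** * Walks and neighbourhoods in the dumbbell graph *)

(** Used to transport the finite type structure, which sums over the vertices require. *)
Definition sum_of_dumbbell (a b k : nat) (v : dumbbell_vertex a b k) : 'I_a + 'I_k + 'I_b :=
  match v with
  | LeftCycle i => inl (inl i)
  | PathInternal i => inl (inr i)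
  | RightCycle i => inr i
  end.

Definition dumbbell_of_sum (a b k : nat) (v : 'I_a + 'I_k + 'I_b) : dumbbell_vertex a b k :=
  match v with
  | inl (inl i) => LeftCycle b k i
  | inl (inr i) => PathInternal a b i
  | inr i => RightCycle a k i
  end.

Lemma sum_of_dumbbellK (a b k : nat) :
  cancel (@sum_of_dumbbell a b k) (@dumbbell_of_sum a b k).
Proof. by case. Qed.

HB.instance Definition _ (a b k : nat) :=
  Finite.copy (dumbbell_vertex a b k) (can_type (@sum_of_dumbbellK a b k)).

Lemma dumbbell_vertexE (a b k : nat) (u v : dumbbell_vertex a b k) :
  (u == v) = match u, v with
  | LeftCycle i, LeftCycle j => val i == val j
  | PathInternal i, PathInternal j => val i == val j
  | RightCycle i, RightCycle j => val i == val j
  | _, _ => false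
  end.
Proof. by case: u => i; case: v => j. Qed.

(** Reducing the index modulo [a] makes the walk close up at index [a]. *)
Definition left_walk (a b k : nat) (a0 : (0 < a)%N) (i : nat) : dumbbell_vertex a b k :=
  LeftCycle b k (Ordinal (ltn_pmod i a0)).

Definition right_walk (a b k : nat) (b0 : (0 < b)%N) (i : nat) : dumbbell_vertex a b k :=
  RightCycle a k (Ordinal (ltn_pmod i b0)).

(** Index 0 is the left attachment vertex, 1 to k are the internal vertices, and every larger index
    gives the right attachment vertex. *)
Definition path_walk (a b k : nat) (a0 : (0 < a)%N) (b0 : (0 < b)%N) (i : nat) :
    dumbbell_vertex a b k :=
  if i is i'.+1 then
    if insub i' is Some j then PathInternal a b j else right_walk a k b0 0
  else left_walk b k a0 0.

Lemma cycle_arc (n i j : nat) : (2 < n)%N -> (0 < i < n)%N -> (j < n)%N ->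
  ((j == i.+1 %% n) || (i == j.+1 %% n) = (j == i.-1 %% n) || (j == i.+1 %% n))%N.
Proof.
move=> n2 hi hj; rewrite orbC; congr (_ || _).
rewrite [(i.-1 %% n)%N]modn_small; last by lia.
have [jn|jn] := ltnP j.+1 n; first by rewrite modn_small //; apply/eqP/eqP; lia.
by rewrite (_ : j.+1 = n) ?modnn; [apply/eqP/eqP; lia | lia].
Qed.

Lemma cycle_arc0 (n j : nat) : (2 < n)%N -> (j < n)%N ->
  ((j == 1 %% n) || (0 == j.+1 %% n) = (j == 1 %% n) || (j == n.-1 %% n))%N.
Proof.
move=> n2 hj; congr (_ || _).
rewrite [(n.-1 %% n)%N]modn_small; last by lia.
have [jn|jn] := ltnP j.+1 n; first by rewrite modn_small //; apply/eqP/eqP; lia.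
by rewrite (_ : j.+1 = n) ?modnn; [apply/eqP/eqP; lia | lia].
Qed.

(** The critical case is i = n-1, where the successor is 0 and the predecessor n-2 is positive
    because n > 2. *)
Lemma cycle_uniq (n i : nat) : (2 < n)%N -> (0 < i < n)%N -> (i.-1 %% n == i.+1 %% n)%N = false.
Proof.
move=> n2 hi; rewrite [(i.-1 %% n)%N]modn_small; last by lia.
have [jn|jn] := ltnP i.+1 n; first by rewrite modn_small //; apply/eqP; lia.
by rewrite (_ : i.+1 = n) ?modnn; [apply/eqP; lia | lia].
Qed.

Section Dumbbell.

Variables (a b k : nat) (a2 : (2 < a)%N) (b2 : (2 < b)%N) (k0 : (0 < k)%N).
Let a0 : (0 < a)%N := ltnW (ltnW a2).
Let b0 : (0 < b)%N := ltnW (ltnW b2).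
Let left := left_walk b k a0.
Let right := right_walk a k b0.
Let path := path_walk k a0 b0.

Lemma neighbours_left (i : nat) : (0 < i < a)%N ->
  neighbours (@dumbbell a b k) (left i) [:: left i.-1; left i.+1].
Proof.
move=> hi; split; first by rewrite /= inE dumbbell_vertexE /= cycle_uniq.
have ia : (i %% a = i)%N by rewrite modn_small //; lia.
case=> j; rewrite !inE !dumbbell_vertexE /dumbbell /=.
- by rewrite -!val_eqE /= !ia; apply: cycle_arc.
- by rewrite ia; case: eqP => //; lia.
- by rewrite ia; case: (i =P 0%N) => [|_]; [lia | rewrite andbF].
Qed.

Lemma neighbours_left0 :
  neighbours (@dumbbell a b k) (left 0) [:: left 1; left a.-1; path 1].
Proof.
rewrite /path /=; case: insubP => [z _ z0|]; last by rewrite k0.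
split.
  by rewrite /= !inE !dumbbell_vertexE /= !modn_small //; [case: eqP => // | ..]; lia.
case=> j; rewrite !inE !dumbbell_vertexE /dumbbell /= ?mod0n.
- by rewrite -!val_eqE /= ?mod0n orbF; apply: cycle_arc0.
- by rewrite z0 orbF.
- by case: (k =P 0%N) => [|_] //; lia.
Qed.

Lemma neighbours_right (i : nat) : (0 < i < b)%N ->
  neighbours (@dumbbell a b k) (right i) [:: right i.-1; right i.+1].
Proof.
move=> hi; split; first by rewrite /= inE dumbbell_vertexE /= cycle_uniq.
have ia : (i %% b = i)%N by rewrite modn_small //; lia.
case=> j; rewrite !inE !dumbbell_vertexE /dumbbell /=.
- by rewrite ia; case: (i =P 0%N) => [|_]; [lia | rewrite !andbF].
- by rewrite ia; case: (i =P 0%N) => [|_]; [lia | rewrite !andbF].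
- by rewrite -!val_eqE /= !ia; apply: cycle_arc.
Qed.

Lemma path_walk_internal (i : nat) (ik : (i < k)%N) :
  path i.+1 = PathInternal a b (Ordinal ik).
Proof. by rewrite /path /= insubT. Qed.

Lemma path_walk_last (i : nat) : (k <= i)%N -> path i.+1 = right 0.
Proof. by move=> ki; rewrite /path /= insubF // ltnNge ki. Qed.

Lemma neighbours_right0 :
  neighbours (@dumbbell a b k) (right 0) [:: right 1; right b.-1; path k].
Proof.
have kk : (k.-1 < k)%N by lia.
have -> : path k = PathInternal a b (Ordinal kk).
  by rewrite -path_walk_internal prednK.
split.
  by rewrite /= !inE !dumbbell_vertexE /= !modn_small //; [case: eqP => // | ..]; lia.
case=> j; rewrite !inE !dumbbell_vertexE /dumbbell /= ?mod0n.
- by case: (k =P 0%N) => [|_] //; lia.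
- by rewrite andbT; apply/eqP/eqP; lia.
- by rewrite -!val_eqE /= ?mod0n orbF; apply: cycle_arc0.
Qed.

Lemma neighbours_path (i : nat) : (0 < i < k.+1)%N ->
  neighbours (@dumbbell a b k) (path i) [:: path i.-1; path i.+1].
Proof.
case: i => // i ik; rewrite -[i.+1.-1]/i path_walk_internal.
(* The first internal vertex is separate because its predecessor is on the left cycle. Each case
   then splits on whether the vertex is the last one, whose successor is on the right cycle. *)
case: i ik => [|i] ik.
  rewrite -[path 0]/(left 0).
  have [k1|k1] := ltnP 1 k.
    rewrite path_walk_internal; split=> //.
    case=> j; rewrite !inE !dumbbell_vertexE /dumbbell /= ?mod0n.
    - by rewrite andbT orbF.
    - by rewrite orbF.
    - by case: (1%N =P k) => [|_] //; lia.
  have k_1 : k = 1%N by lia.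
  rewrite path_walk_last //.
  split=> //; case=> j; rewrite !inE !dumbbell_vertexE /dumbbell /= ?mod0n.
  - by rewrite andbT orbF.
  - by apply/negbTE; case: j => j /=; lia.
  - by rewrite k_1 orbF.
have ik1 : (i < k)%N by lia.
rewrite (path_walk_internal ik1).
have [k1|k1] := ltnP i.+2 k.
  rewrite path_walk_internal; split.
    by rewrite /= inE dumbbell_vertexE /=; apply/andP; split=> //; apply/eqP; lia.
  case=> j; rewrite !inE !dumbbell_vertexE /dumbbell /= ?mod0n.
  - by rewrite andbF.
  - by rewrite orbC eqSS [X in X || _]eq_sym.
  - by case: (i.+2 =P k) => [|_] //; lia.
have k_i : k = i.+2 by lia.
rewrite path_walk_last //.
split=> //; case=> j; rewrite !inE !dumbbell_vertexE /dumbbell /= ?mod0n.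
- by rewrite andbF.
- by case: j => j /=; lia.
- by rewrite k_i eqxx orbF.
Qed.

End Dumbbell.

(** * Bipartition of the dumbbell, invertibility, and the conclusion *)

(** For even cycles this is the parity of the distance to vertex 0 of the left cycle: internal
    vertex i is at distance i+1, and vertex 0 of the right cycle at distance k+1. *)
Definition dumbbell_side (a b k : nat) (v : dumbbell_vertex a b k) : bool :=
  match v with
  | LeftCycle i => odd i
  | PathInternal i => ~~ odd i
  | RightCycle i => odd i (+) ~~ odd k
  end.

Lemma dumbbell_bipartite (a b k : nat) (u v : dumbbell_vertex a b k) :
  ~~ odd a -> ~~ odd b -> dumbbell u v -> dumbbell_side u != dumbbell_side v.
Proof.
move=> a_even b_even.
have arc y z : @dumbbell_arc a b k y z -> dumbbell_side y != dumbbell_side z.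
  case: y => i; case: z => j //=.
  (* Evenness of [a] makes the closing arc from a-1 to 0 change parity too. *)
  - by move/eqP=> ->; rewrite /= odd_mod ?(negbTE a_even) //=; case: odd.
  - by case/andP => /eqP -> /eqP ->.
  - by case/and3P => /eqP -> /eqP -> /eqP ->.
  - by move/eqP=> ->; rewrite /=; case: odd.
  - by case/andP => /eqP/(congr1 odd) /= <- /eqP ->; case: odd.
  - by move/eqP=> ->; rewrite /= odd_mod ?(negbTE b_even) //=; do 2 case: odd.
by case/orP => /arc //; rewrite eq_sym.
Qed.

Lemma dumbbell_null_vector_eq0 (F : realFieldType) (p q l : nat)
    (w : dumbbell_vertex (4 * p + 2) (4 * q + 2) (2 * l) ->
         dumbbell_vertex (4 * p + 2) (4 * q + 2) (2 * l) -> F)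
    (x : dumbbell_vertex (4 * p + 2) (4 * q + 2) (2 * l) -> F) :
  (0 < p)%N -> (0 < q)%N -> (0 < l)%N ->
  weights (@dumbbell _ _ _) w -> null_vector w x -> forall v, x v = 0.
Proof.
move=> p0 q0 l0 we wx.
have a2 : (2 < 4 * p + 2)%N by lia.
have b2 : (2 < 4 * q + 2)%N by lia.
have k0 : (0 < 2 * l)%N by lia.
have aE : (4 * p + 1 = (4 * p + 2).-1)%N by lia.
have bE : (4 * q + 1 = (4 * q + 2).-1)%N by lia.
have nL0 := neighbours_left0 a2 b2 k0; rewrite -aE in nL0.
have nR0 := neighbours_right0 a2 b2 k0; rewrite -bE in nR0.
have [|left0 left_eq0] := null_vector_cycle we wx _ (neighbours_left a2 b2 k0) nL0.
  by congr LeftCycle; apply: val_inj; rewrite /= modnn mod0n.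
have [|right0 right_eq0] := null_vector_cycle we wx _ (neighbours_right a2 b2 k0) nR0.
  by congr RightCycle; apply: val_inj; rewrite /= modnn mod0n.
have path_eq0 := null_vector_path we wx (neighbours_path a2 b2 k0) left0.
rewrite path_walk_last // in path_eq0.
have {}path_eq0 := path_eq0 right0.
(* The path is settled first: its first and last internal vertices are the outer neighbours at which
   [left_eq0] and [right_eq0] need x to vanish. *)
case=> i.
- rewrite -(left_eq0 _ i) ?path_eq0 //; last exact: ltnW.
  by congr (x (LeftCycle _ _ _)); apply: val_inj; rewrite /= modn_small.
- rewrite -(path_eq0 i.+1) ?leqW // path_walk_internal.
  by congr (x (PathInternal _ _ _)); apply: val_inj.
- rewrite -(right_eq0 _ i) ?path_eq0 //; last exact: ltnW.
  by congr (x (RightCycle _ _ _)); apply: val_inj; rewrite /= modn_small.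
Qed.

Theorem theorem3p8 (R : realType) (p q l : nat)
    (hp : (0 < p)%N) (hq : (0 < q)%N) (hl : (0 < l)%N)
    (N : nat) (P : 'M[sign]_N)
    (Psym : symmetric_pattern P)
    (Pnonneg : nonnegative_pattern P)
    (Pdiag : zero_diagonal P)
    (PG : graph_iso (underlying_graph P)
            (@dumbbell (4 * p + 2)%N (4 * q + 2)%N (2 * l)%N)) :
  requires_full_P_vertices R P.
Proof.
move=> A [symA sgA] j; case: PG => f [g fK gK] fE.
have wA i k : if underlying_graph P i k then 0 < A i k else A i k == 0.
  rewrite /underlying_graph; have := sgA i k.
  by case: (Pnonneg i k) => -> /= /eqP; rewrite ?sgz_eq0 ?sgz_cp0.
have uA : A \in unitmx.
  rewrite unitmxE unitfE; apply/det0P => -[v /negP vN0 vA]; apply: vN0.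
  apply/eqP/rowP => i; rewrite mxE -(fK i).
  apply: (dumbbell_null_vector_eq0 (w := fun u v => A (g u) (g v))
            (x := fun u => v 0 (g u))) => //.
    by move=> u z; have := wA (g u) (g z); rewrite fE !gK.
  (* Symmetry of A turns the row equation v A = 0 into the equations of a null vector, reindexed
     along the isomorphism. *)
  move=> u; transitivity ((v *m A) 0 (g u)); last by rewrite vA mxE.
  rewrite mxE (reindex g) /=; last by exists f => ? _.
  by apply: eq_bigr => z _; rewrite mulrC -{1}symA mxE.
rewrite /P_vertex /mult0 (mup0_char_poly_unit uA) mup0_char_poly_minor //.
apply: (invmx_diag_eq0 (side := fun i => dumbbell_side (f i)) _ uA) => i k side_ik.
have := wA i k; case: ifP => [|_ /eqP //].
rewrite fE => fik; have := dumbbell_bipartite _ _ fik.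
by rewrite side_ik eqxx => h; have : false by apply: h; lia.
Qed.
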